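(* Let $M$ be a finite $C$-algebra with $T,F,U$. Then $M$ is atomic if and only if $M$ is an ada (i.e. $M$ carries a unary operation $(\cdot)^{\downarrow}$ making it an ada).
   Context: A $C$-algebra is an algebra $\langle M,\vee,\wedge,\neg\rangle$ of type $(2,2,1)$ satisfying, for all $\alpha,\beta,\gamma$: $\neg\neg\alpha=\alpha$; $\neg(\alpha\wedge\beta)=\neg\alpha\vee\neg\beta$; $(\alpha\wedge\beta)\wedge\gamma=\alpha\wedge(\beta\wedge\gamma)$; $\alpha\wedge(\beta\vee\gamma)=(\alpha\wedge\beta)\vee(\alpha\wedge\gamma)$; $(\alpha\vee\beta)\wedge\gamma=(\alpha\wedge\gamma)\vee(\neg\alpha\wedge\beta\wedge\gamma)$; $\alpha\vee(\alpha\wedge\beta)=\alpha$; $(\alpha\wedge\beta)\vee(\beta\wedge\alpha)=(\beta\wedge\alpha)\vee(\alpha\wedge\beta)$. A $C$-algebra with $T,F,U$ has nullary operations $T,F,U$: $T$ is the two-sided identity for $\wedge$, $F$ the two-sided identity for $\vee$, $U$ the fixed point of $\neg$. An ada is a $C$-algebra with $T,F,U$ together with a unary operation $(\cdot)^{\downarrow}$ satisfying $F^{\downarrow}=F$, $U^{\downarrow}=F$, $T^{\downarrow}=T$, $\alpha\wedge\beta^{\downarrow}=\alpha\wedge(\alpha\wedge\beta)^{\downarrow}$, $\alpha^{\downarrow}\vee\neg(\alpha^{\downarrow})=T$, $\alpha=\alpha^{\downarrow}\vee\alpha$. Order: $a\leq b$ iff $a\vee b=b$. An atom is $a\neq F$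 such that every $b$ with $F\leq b\leq a$, $b\neq a$ equals $F$. For finitely many atoms $a_1,\dots,a_N$: if $a_{\sigma(1)}\vee\cdots\vee a_{\sigma(N)}=a_1\vee\cdots\vee a_N$ for every bijection $\sigma$ of $\{1,\dots,N\}$, then $\bigoplus_{i=1}^N a_i$ exists and equals this value. $M$ is atomic if every $a\neq F$ in $M$ equals $\bigoplus_{i=1}^N a_i$ for some finite set of atoms. *)

(* Defs.v *)
From HB Require Import structures.
From mathcomp Require Import all_boot all_fingroup.
Set Implicit Arguments. Unset Strict Implicit. Unset Printing Implicit Defensive.

HB.mixin Record isCAlgebra (M : Type) := {
  vee : M -> M -> M;
  wedge : M -> M -> M;
  neg : M -> M;
  negK : forall a, neg (neg a) = a;
  neg_wedge : forall a b, neg (wedge a b) = vee (neg a) (neg b);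
  wedgeA : forall a b c, wedge (wedge a b) c = wedge a (wedge b c);
  wedge_veer : forall a b c,
    wedge a (vee b c) = vee (wedge a b) (wedge a c);
  wedge_veel : forall a b c,
    wedge (vee a b) c = vee (wedge a c) (wedge (wedge (neg a) b) c);
  vee_absorb : forall a b, vee a (wedge a b) = a;
  vee_wedgeC : forall a b,
    vee (wedge a b) (wedge b a) = vee (wedge b a) (wedge a b)
}.

HB.structure Definition CAlgebra := { M of isCAlgebra M }.

HB.mixin Record CAlgebra_hasTFU (M : Type) of CAlgebra M := {
  cT : M;
  cF : M;
  cU : M;
  wedgeT : right_id cT (@wedge M);
  Twedge : left_id cT (@wedge M);
  veeF : right_id cF (@vee M);
  Fvee : left_id cF (@vee M);
  negU : neg cU = cU
}.

#[short(type="cAlgebraTFUType")]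
HB.structure Definition CAlgebraTFU := { M of isCAlgebra M & CAlgebra_hasTFU M }.

#[short(type="finCAlgebraTFUType")]
HB.structure Definition FinCAlgebraTFU :=
  { M of Finite M & isCAlgebra M & CAlgebra_hasTFU M }.

Record ada_operation (M : cAlgebraTFUType) (down : M -> M) : Prop := AdaOperation {
  downF : down cF = cF;
  downU : down cU = cF;
  downT : down cT = cT;
  wedge_down : forall a b, wedge a (down b) = wedge a (down (wedge a b));
  down_compl : forall a, vee (down a) (neg (down a)) = cT;
  down_vee : forall a, a = vee (down a) a
}.

Definition is_ada (M : cAlgebraTFUType) : Prop :=
  exists down : M -> M, ada_operation down.

Definition cle (M : cAlgebraTFUType) (a b : M) : Prop := vee a b = b.

Definition atom (M : cAlgebraTFUType) (a : M) : Prop :=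
  a <> cF /\ forall b : M, cle cF b -> cle b a -> b <> a -> b = cF.

(* [vee] is associative but not commutative, so the value of this iterated
   join depends on the order in which the family is listed. *)
Definition join_family (M : cAlgebraTFUType) (N : nat) (a : 'I_N -> M) : M :=
  \big[@vee M/cF]_(i < N) a i.

(* "The sum of the family [a] exists and equals [v]". *)
Definition is_oplus (M : cAlgebraTFUType) (N : nat) (a : 'I_N -> M) (v : M) : Prop :=
  (forall s : {perm 'I_N}, join_family (fun i => a (s i)) = join_family a)
  /\ v = join_family a.

(* A finite set of atoms is presented by an injective enumeration; the empty
   one plays no role, since its join is [cF]. *)
Definition atomic (M : cAlgebraTFUType) : Prop :=
  forall x : M, x <> cF ->
    exists (N : nat) (a : 'I_N -> M),
      [/\ injective a, forall i, atom (a i) & is_oplus a x].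

(* Main.v *)
Require Import Defs.
From HB Require Import structures.
From mathcomp Require Import all_boot all_fingroup.
Set Implicit Arguments. Unset Strict Implicit. Unset Printing Implicit Defensive.

(** A finite C-algebra M with T, F, U has enough morphisms to the three-element
    C-algebra {T, F, U} to separate its points, so M may be viewed as a
    subalgebra of a power of it and identities may be checked coordinatewise.
    There a <= b means that each coordinate of a is F or agrees with that of b,
    and an ada operation has to replace every coordinate U by F.
    - If M is an ada, "a where b is F, and F elsewhere" is a term, so an element
      minimal among those below x and not F at a given coordinate is an atom;
      hence x is the join of the atoms below it, and elements with a common
      upper bound join in any order.
    - If M is atomic and x is a sum of atoms b_i, permutation invariance gives
      b_i <= x.  An atom b with some coordinate T has no coordinate U, because
      b /\ F < b is then F.  So the join of the b_i without a coordinate U is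
      the required value of the ada operation at x. *)

(** * Identities of C-algebras with T, F, U *)

Section Identities.
Variable M : cAlgebraTFUType.
Implicit Types a b c x y : M.

Lemma neg_vee a b : neg (vee a b) = wedge (neg a) (neg b).
Proof. by rewrite -[RHS]negK neg_wedge !negK. Qed.

Lemma negF : neg cF = cT :> M.
Proof. by rewrite -[LHS]wedgeT -[cT in LHS]negK -neg_vee Fvee negK. Qed.

Lemma negT : neg cT = cF :> M.
Proof. by rewrite -negF negK. Qed.

Lemma wedge_absorb a b : wedge a (vee a b) = a.
Proof. by rewrite -[LHS]negK neg_wedge (neg_vee a) vee_absorb negK. Qed.

Lemma wedgeI a : wedge a a = a.
Proof. by rewrite -[X in wedge a X]veeF wedge_absorb. Qed.

Lemma Fwedge a : wedge cF a = cF.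
Proof. by rewrite -[a]Fvee wedge_absorb. Qed.

Lemma vee_neg_wedge a b : vee a (wedge (neg a) b) = vee a b.
Proof. by rewrite -[RHS]wedgeT wedge_veel !wedgeT. Qed.

Lemma wedge_neg_vee a b : wedge a (vee (neg a) b) = wedge a b.
Proof.
by rewrite -[LHS]negK neg_wedge (neg_vee (neg a) b) vee_neg_wedge neg_vee !negK.
Qed.

Lemma wedge_neg a : wedge a (neg a) = wedge a cF.
Proof. by rewrite -[RHS]wedge_neg_vee veeF. Qed.

Lemma Uwedge a : wedge cU a = cU.
Proof.
have UF : wedge cU cF = cU :> M by rewrite -wedge_neg negU wedgeI.
by rewrite -UF wedgeA Fwedge.
Qed.

Lemma vee_wedge_self a b : vee (wedge a b) a = wedge a (vee b a).
Proof.
rewrite -[LHS]negK (neg_vee (wedge a b)) (neg_wedge a) wedge_veel wedgeI wedgeA.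
by rewrite vee_neg_wedge neg_vee neg_wedge !negK.
Qed.

(** With [p = wedge a b] and [r = wedge p a], multiplying [vee_wedgeC] by [a] on the left gives
    [vee r p = p], and absorption yields [r = wedge r p = p]. *)
Lemma wedge_regular a b : wedge (wedge a b) a = wedge a b.
Proof.
set p := wedge a b; set r := wedge p a.
have rp : wedge r p = p by rewrite /r wedgeA -[wedge a p]wedgeA wedgeI wedgeI.
have pr : vee r p = p.
  have := congr1 (wedge a) (vee_wedgeC a b).
  by rewrite !wedge_veer -!wedgeA wedgeI vee_absorb => <-.
by rewrite -[RHS]rp -[in RHS]pr wedge_absorb.
Qed.

End Identities.

(** * Morphisms to the three-element algebra *)

(* [Some true], [Some false] and [None] encode T, F and U. *)
Notation three := (option bool).
Definition vee3 (u v : three) := if u is Some false then v else u.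
Definition wedge3 (u v : three) := if u is Some true then v else u.

Record morphism3 (M : cAlgebraTFUType) (h : M -> three) : Prop := Morphism3 {
  morph3_vee : forall a b, h (vee a b) = vee3 (h a) (h b);
  morph3_wedge : forall a b, h (wedge a b) = wedge3 (h a) (h b);
  morph3_neg : forall a, h (neg a) = omap negb (h a);
  morph3_T : h cT = Some true;
  morph3_F : h cF = Some false;
  morph3_U : h cU = None
}.

Definition morph3E (M : cAlgebraTFUType) (h : M -> three) (hh : morphism3 h) :=
  (morph3_vee hh, morph3_wedge hh, morph3_neg hh,
   morph3_T hh, morph3_F hh, morph3_U hh).

Section Separation.
Variable M : finCAlgebraTFUType.
Implicit Types a b c x y z : M.

(* In a power of the three-element algebra: [a] is T only where [b] is. *)
Let imp a b := wedge a b == a.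

Let imp_trans a b c : imp a b -> imp b c -> imp a c.
Proof. by move=> /eqP ab /eqP bc; rewrite /imp -ab wedgeA bc. Qed.

Let imp_wedgel a b : imp (wedge a b) a.
Proof. by rewrite /imp wedge_regular. Qed.

Let imp_wedger a b : imp (wedge a b) b.
Proof. by rewrite /imp wedgeA wedgeI. Qed.

Let imp_wedge c a b : imp c (wedge a b) = imp c a && imp c b.
Proof.
apply/idP/andP=> [cab|[/eqP ca /eqP cb]].
  by split; apply: imp_trans cab _; rewrite (imp_wedgel, imp_wedger).
by rewrite /imp -wedgeA ca cb.
Qed.

Let imp_vee a b y : imp a y -> imp (wedge (neg a) b) y -> imp (vee a b) y.
Proof.
by move=> /eqP ay /eqP aby; rewrite /imp wedge_veel ay aby vee_neg_wedge.
Qed.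

(* A finite-algebra form of the prime filter theorem: the filter generated by a
   [c] chosen with as many consequences as possible is the preimage of T. *)
Lemma morph3_imp x y : ~~ imp x y ->
  exists2 h : M -> three, morphism3 h &
    (h x == Some true) && (h y != Some true).
Proof.
move=> xy; pose Q c := imp c x && ~~ imp c y.
have Qx : Q x by rewrite /Q /imp wedgeI eqxx.
case: (@arg_maxnP _ x Q (fun c => #|[set z | imp c z]|) Qx).
move=> c /andP[cx cy] cmax.
(* By maximality of [c], any [a] that can be adjoined without yielding [y] is already a
   consequence. *)
have cmaxW a : ~~ imp (wedge c a) y -> imp c a.
  move=> cay; have sub : [set z | imp c z] \subset [set z | imp (wedge c a) z].
    by apply/subsetP=> z; rewrite !inE; apply: imp_trans.
  have Qca : Q (wedge c a) by rewrite /Q cay (imp_trans (imp_wedgel _ _) cx).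
  have /eqP eqs : [set z | imp c z] == [set z | imp (wedge c a) z].
    by rewrite eqEcard sub; apply: cmax.
  have : a \in [set z | imp (wedge c a) z] by rewrite inE.
  by rewrite -eqs inE.
have absorbing z : (forall u, wedge z u = z) -> ~~ imp c z.
  move=> zu; apply/negP=> /eqP cz; case/negP: cy.
  by rewrite /imp -cz wedgeA zu.
have cF' : imp c cF = false by apply/negbTE/absorbing/Fwedge.
have cU' : imp c cU = false by apply/negbTE/absorbing/Uwedge.
have cT' : imp c cT by rewrite /imp wedgeT.
have cN a : imp c a -> imp c (neg a) = false.
  move=> ca; apply/negbTE/negP=> cna.
  by move: (imp_wedge c a (neg a)); rewrite wedge_neg imp_wedge cF' ca cna.
have cV a b : imp c (vee a b) = imp c a || imp c (neg a) && imp c b.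
  apply/idP/orP=> [/eqP cab|].
    case: (boolP (imp (wedge c a) y)) => [cay|]; last by move/cmaxW; left.
    case: (boolP (imp (wedge c (wedge (neg a) b)) y)) => [cby|].
      case/negP: cy; rewrite -cab -vee_neg_wedge wedge_veer; apply: imp_vee => //.
      by apply: imp_trans (imp_wedger _ _) cby.
    by move/cmaxW; rewrite imp_wedge; right.
  case=> [/eqP ca|/andP[/eqP cna /eqP cb]]; rewrite /imp wedge_veer.
    by rewrite ca vee_absorb.
  (* Since [c] implies [neg a], the term [wedge c a] collapses to [wedge c cF]. *)
  rewrite cb -{1}cna wedgeA -{2}[a]negK wedge_neg -wedgeA cna.
  by rewrite vee_wedge_self Fvee wedgeI.
pose h a : three :=
  if imp c a then Some true else if imp c (neg a) then Some false else None.
exists h; last by rewrite /h cx (negbTE cy); case: ifP.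
split=> [a b|a b|a||| ]; rewrite /h ?negT ?negF ?negU ?cT' ?cF' ?cU' //.
- rewrite neg_vee imp_wedge cV; move: (cN a).
  by case: (imp c a) => [->|_] //; case: (imp c (neg a)); case: (imp c b).
- rewrite neg_wedge imp_wedge cV negK; move: (cN a).
  by case: (imp c a) => [->|_] //; case: (imp c (neg a)); case: (imp c b).
- rewrite negK; move: (cN a).
  by case: (imp c a) => [->|_] //; case: (imp c (neg a)).
Qed.

(** [morph3_imp] detects only the value T, which gives [wedge x y = x]; on negations it gives the
    dual [vee x y = x]. With the same for [x] and [y] exchanged, [vee_wedgeC] becomes [x = y]. *)
Lemma morph3_ext x y : (forall h : M -> three, morphism3 h -> h x = h y) -> x = y.
Proof.
move=> hxy.
have impE a b : (forall h : M -> three, morphism3 h -> h a = h b) -> wedge a b = a.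
  move=> hab; apply/eqP; apply: contraT => /morph3_imp[h hh].
  by rewrite (hab h hh) andbN.
have xVy : vee x y = x.
  rewrite -[LHS]negK neg_vee impE ?negK // => h hh.
  by rewrite !morph3E // hxy.
have yVx : vee y x = y.
  rewrite -[LHS]negK neg_vee impE ?negK // => h hh.
  by rewrite !morph3E // hxy.
have xWy : wedge x y = x by apply: impE.
have yWx : wedge y x = y by apply: impE => h hh; rewrite hxy.
by have := vee_wedgeC x y; rewrite xWy yWx xVy yVx.
Qed.

End Separation.

Lemma morph3_le (M : cAlgebraTFUType) (h : M -> three) (a b : M) :
  morphism3 h -> cle a b -> vee3 (h a) (h b) = h b.
Proof. by move=> hh /(congr1 h); rewrite morph3_vee. Qed.

(** Under a common upper bound [x], the first value other than F decides the join and agrees with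
    that of [x], so order is irrelevant. *)
Lemma morph3_big (M : cAlgebraTFUType) (h : M -> three) (I : Type) (s : seq I)
    (P : pred I) (f : I -> M) (x : M) : morphism3 h ->
  (forall i, P i -> cle (f i) x) ->
  h (\big[@vee M/cF]_(i <- s | P i) f i) =
    if has (fun i => P i && (h (f i) != Some false)) s then h x else Some false.
Proof.
move=> hh fx; elim: s => [|i s IH]; first by rewrite big_nil morph3_F.
rewrite big_cons /=; case: ifP => //= Pi; rewrite morph3_vee // IH.
by have := morph3_le hh (fx i Pi); case: (h (f i)) => [[]|] //= ->.
Qed.

(** * The ada operation *)

(** Coordinatewise, the equations force in turn that [d] is never U, is T only where [x] is T, and
    is T wherever [x] is T. *)
Definition is_down (M : finCAlgebraTFUType) (x d : M) :=
  [&& vee d (neg d) == cT, vee d x == x & wedge x d == x].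

Lemma morph3_down (M : finCAlgebraTFUType) (x d : M) (h : M -> three) :
  morphism3 h -> is_down x d -> h d = Some (h x == Some true).
Proof.
move=> hh /and3P[/eqP/(congr1 h) + /eqP/(congr1 h) + /eqP/(congr1 h)].
by rewrite !morph3E //; case: (h x) (h d) => [[]|] [[]|].
Qed.

Lemma is_adaP (M : finCAlgebraTFUType) :
  is_ada M <-> forall x : M, exists d : M, is_down x d.
Proof.
split=> [[down [_ _ dT dW dC dV]] x|exd].
  exists (down x); rewrite /is_down dC -dV !eqxx /=.
  (* At [b = cT] the axiom [wedge_down] reads [x = wedge x (down x)]. *)
  by have := dW x cT; rewrite dT wedgeT => <-.
pose down x := xchoose (exd x).
have downE h x : morphism3 h -> h (down x) = Some (h x == Some true).
  by move=> hh; apply: morph3_down => //; apply: xchooseP.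
exists down; split=> [|||a b|a|a]; apply: morph3_ext => h hh;
  rewrite !morph3E // !downE // ?morph3E //.
- by case: (h a) => [[]|].
- by case: (h a) => [[]|].
- by case: (h a) => [[]|].
Qed.

(** A transposition brings [a i] to the front, and a first joinand is below its join. *)
Lemma oplus_le (M : finCAlgebraTFUType) (N : nat) (a : 'I_N -> M) (x : M) i :
  is_oplus a x -> cle (a i) x.
Proof.
case: N a i => [|n] a i [perm_join ->]; first by case: i.
rewrite -(perm_join (tperm ord0 i)) /join_family big_ord_recl tpermL.
apply: morph3_ext => h hh; rewrite !morph3E //.
by case: (h (a i)) => [[]|].
Qed.

Lemma atom_no_U (M : finCAlgebraTFUType) (a : M) (h h' : M -> three) :
  atom a -> morphism3 h -> morphism3 h' -> h a = Some true -> h' a <> None.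
Proof.
move=> [_ amin] hh hh' ha h'a.
have aF : wedge a cF = cF.
  apply: amin; rewrite /cle ?Fvee //.
    by apply: morph3_ext => k hk; rewrite !morph3E //; case: (k a) => [[]|].
  by move/(congr1 h); rewrite !morph3E // ha.
by move/(congr1 h'): aF; rewrite !morph3E // h'a.
Qed.

Lemma atomic_ada (M : finCAlgebraTFUType) : atomic M -> is_ada M.
Proof.
move=> atM; apply/is_adaP=> x.
have [->|/eqP /atM[N [a [_ ata ax]]]] := eqVneq x cF.
  by exists cF; rewrite /is_down negF !Fvee Fwedge !eqxx.
have a_le i : cle (a i) x by apply: oplus_le ax.
(* Coordinatewise, [B i] says that [a i] never takes the value U. *)
pose B i := vee (a i) (neg (a i)) == cT.
pose d := \big[@vee M/cF]_(i < N | B i) a i.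
suff dE (h : M -> three) : morphism3 h -> h d = Some (h x == Some true).
  exists d; apply/and3P; split; apply/eqP/morph3_ext => h hh;
    rewrite !morph3E // dE //; by case: (h x) => [[]|].
move=> hh; rewrite (morph3_big _ hh (x := x)) //.
have xE := morph3_big (index_enum 'I_N) hh (fun i (_ : xpredT i) => a_le i).
rewrite -[X in h X = _](proj2 ax) /= in xE.
case: hasP => [[i _ /andP[/eqP/(congr1 h)]]|nB].
  by have := morph3_le hh (a_le i); rewrite !morph3E //;
     case: (h (a i)) => [[]|] //= <-.
congr Some; apply/esym/negbTE/eqP => hx; move: xE; rewrite hx.
case: hasP => // -[i _ hai] _; apply: nB; exists i; rewrite ?mem_index_enum //.
rewrite hai andbT.
have {}hai : h (a i) = Some true.
  by have := morph3_le hh (a_le i); rewrite hx; case: (h (a i)) hai => [[]|].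
apply/eqP/morph3_ext => k hk; rewrite !morph3E //.
by have := atom_no_U (ata i) hh hk hai; case: (k (a i)) => [[]|].
Qed.

Section AdaAtomic.
Variables (M : finCAlgebraTFUType).
Hypothesis exd : forall x : M, exists d : M, is_down x d.
Implicit Types a b x : M.

Let atomb a :=
  (a != cF) && [forall b, (vee b a == a) ==> (b != a) ==> (b == cF)].

Let atombP a : reflect (atom a) (atomb a).
Proof.
apply: (iffP andP) => [[/eqP aF /forallP amin]|[/eqP aF amin]]; split=> //.
  move=> b _ /eqP ba /eqP bna; apply/eqP.
  by have := amin b; rewrite ba bna.
apply/forallP=> b; apply/implyP=> /eqP ba; apply/implyP=> /eqP bna; apply/eqP.
by apply: amin => //; rewrite /cle Fvee.
Qed.

Lemma ada_diff a b : exists2 c : M, cle c a &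
  forall h : M -> three, morphism3 h ->
    h c = if h b == Some false then h a else Some false.
Proof.
(* [d] is T exactly where [b] is T, and [e] exactly where [b] is not U; hence [wedge e (neg d)] is T
   where [b] is F, and F elsewhere. *)
have [d bd] := exd b; have [e be] := exd (vee b cT).
pose c := wedge (wedge e (neg d)) a.
have cE (h : M -> three) : morphism3 h ->
    h c = if h b == Some false then h a else Some false.
  move=> hh; rewrite !morph3E // (morph3_down hh bd) (morph3_down hh be).
  by rewrite !morph3E //; case: (h b) => [[]|].
exists c => //; apply: morph3_ext => h hh; rewrite morph3_vee // cE //.
by case: ifP => // _; case: (h a) => [[]|].
Qed.

Lemma ada_atom_below x (h : M -> three) : morphism3 h -> h x <> Some false ->
  exists a, [/\ atom a, cle a x & h a <> Some false].
Proof.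
move=> hh /eqP hx; pose Q a := (vee a x == x) && (h a != Some false).
have le_trans a b c : cle a b -> cle b c -> cle a c.
  move=> ab bc; apply: morph3_ext => k hk; rewrite morph3_vee //.
  have := morph3_le hk ab; have := morph3_le hk bc.
  by case: (k a) (k b) (k c) => [[]|] [[]|] [[]|].
have lexx a : cle a a.
  by apply: morph3_ext => k hk; rewrite morph3_vee //; case: (k a) => [[]|].
have le_anti a b : cle a b -> cle b a -> a = b.
  move=> ab ba; apply: morph3_ext => k hk.
  have := morph3_le hk ab; have := morph3_le hk ba.
  by case: (k a) (k b) => [[]|] [[]|].
have Qx : Q x by rewrite /Q hx andbT; apply/eqP/lexx.
(* Fewest lower bounds within [Q] ensures minimality for the order. *)
case: (@arg_minnP _ x Q (fun c => #|[set z : M | vee z c == c]|) Qx).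
move=> a /andP[/eqP ax ha] amin; exists a; split=> //; last exact/eqP.
have {}amin c : cle c a -> h c <> Some false -> c = a.
  move=> ca /eqP hc; apply: le_anti => //.
  have sub : [set z : M | vee z c == c] \subset [set z | vee z a == a].
    by apply/subsetP=> z; rewrite !inE => /eqP zc; apply/eqP/(le_trans _ c).
  have Qc : Q c by rewrite /Q hc andbT; apply/eqP/(le_trans _ a).
  have /eqP eqs : [set z : M | vee z c == c] == [set z | vee z a == a].
    by rewrite eqEcard sub; apply: amin.
  have : a \in [set z : M | vee z a == a] by rewrite inE; apply/eqP/lexx.
  by rewrite -eqs inE => /eqP.
split=> [aF|b _ ba bna]; first by rewrite aF morph3_F in ha.
have hb : h b = Some false by apply/eqP/negPn/negP=> /eqP /(amin _ ba).
(* Erasing from [a] the support of [b] leaves the value at [h], so by minimality erases nothing; as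
   [b] is below [a], it is F everywhere. *)
have [c ca cE] := ada_diff a b.
have {}ca : c = a by apply: amin; rewrite // cE // hb eqxx; apply/eqP.
apply: morph3_ext => k hk; rewrite morph3_F //.
have := cE k hk; have := morph3_le hk ba; rewrite ca.
by case: (k b) => [[]|] //= <-.
Qed.

Lemma ada_atomic : atomic M.
Proof.
move=> x _; pose A := [set a : M | atomb a & vee a x == x].
pose a (i : 'I_#|A|) : M := enum_val i.
have aA i : atom (a i) /\ cle (a i) x.
  by have := enum_valP i; rewrite inE => /andP[/atombP ? /eqP].
have a_le i : cle (a i) x by case: (aA i).
have joinE (s : {perm 'I_#|A|}) : join_family (fun i => a (s i)) = x.
  apply: morph3_ext => h hh; rewrite (morph3_big _ hh (x := x)) //.
  case: hasP => // nex; apply/esym/eqP/negPn/negP=> /eqP hx.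
  have [b [atb bx /eqP hb]] := ada_atom_below hh hx.
  have bA : b \in A by rewrite inE; apply/andP; split; [apply/atombP|apply/eqP].
  (* The atom [b] occurs in the permuted family at the preimage under [s] of its index. *)
  apply: nex; exists (s^-1 (enum_rank_in bA b))%g; rewrite ?mem_index_enum //.
  by rewrite permKV /a enum_rankK_in.
have join1 : join_family a = x.
  by rewrite -[RHS](joinE 1%g); apply: eq_bigr => i _; rewrite perm1.
exists #|A|, a; split=> [|i|]; first exact: enum_val_inj.
  by case: (aA i).
by split=> [s|]; rewrite ?joinE join1.
Qed.

End AdaAtomic.

Theorem theorem2p53 (M : finCAlgebraTFUType) : atomic M <-> is_ada M.
Proof. by split=> [/atomic_ada //|/is_adaP/ada_atomic]. Qed.
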